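(* Every finite crystallographic reflection group $W$ (i.e. finite Weyl group) is a covering group with respect to $\mathcal{C}\subseteq W\setminus\{e\}$ the set of reflections, i.e. the canonical surjection $G_{\mathcal{C}}\twoheadrightarrow W$ is an isomorphism. Moreover, the IP-quandle $\mathcal{C}$ of reflections is locally skew if and only if the associated Dynkin diagram is simply laced.
   Context: A (left) IP-quandle is a set $\mathcal{C}$ with an operation $(a,b)\mapsto {}^ab$ such that ${}^a({}^bc)={}^{({}^ab)}({}^ac)$, each map ${}^a(\ )$ is bijective, ${}^aa=a$, together with a permutation $a\mapsto a^{-1}$ of $\mathcal{C}$ such that $(a^{-1})^{-1}=a$, ${}^a(b^{-1})=({}^ab)^{-1}$ and ${}^{a^{-1}}({}^ab)=b$ for all $a,b,c\in\mathcal{C}$. If $G$ is a group and $\mathcal{C}\subseteq G\setminus\{e\}$ is stable under conjugation and inversion, then $\mathcal{C}$ is an IP-quandle with ${}^ab=aba^{-1}$ and with group inversion. For an IP-quandle $\mathcal{C}$, the group $G_{\mathcal{C}}$ is generated by $\mathcal{C}$ with relations ${}^ab\,a=ab$ and $a^{-1}a=e$ for all $a,b\in\mathcal{C}$ (here $a^{-1}$ denotes the generator given by the permutation of $\mathcal{C}$). If $\mathcal{C}\subseteq G\setminus\{e\}$ is conjugation-stable, inversion-stable and generates $G$, there is a canonical surjection $G_{\mathcal{C}}\twoheadrightarrow G$ sending each generator $a\in\mathcal{C}$ to $a\in G$. The group $G$ is called a covering group with respect to $\mathcal{C}$ if this map is an isomorphism. Two elements $a,b\in\mathcal{C}$ are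 mutually skew if ${}^ab=({}^ba)^{-1}$. The IP-quandle $\mathcal{C}$ is locally skew if the graph with vertex set $\mathcal{C}$ and an edge between two distinct elements whenever they are mutually skew is connected. A finite Weyl group is the finite group generated by the hyperplane reflections in the roots of a (crystallographic) root system; the associated Dynkin diagram is that of the root system, and it is simply laced if it has no multiple edges.
   Formalization: The direction ''simply laced implies locally skew'' is proved only for connected Dynkin diagrams; without connectedness it is false, e.g. for A1×A1, whose two distinct commuting reflections are not mutually skew. *)

(* Defs.v *)
From HB Require Import structures.
From mathcomp Require Import all_boot all_order all_algebra.
From mathcomp Require Import finmap boolp reals.

Set Implicit Arguments.
Unset Strict Implicit.
Unset Printing Implicit Defensive.

Import Order.TTheory GRing.Theory Num.Theory.

Section Generation.
Local Open Scope group_scope.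
Variables (G : groupType) (S : {pred G}).

Definition generated : {pred G} := fun x =>
  `[< forall H : {pred G}, group_closed H -> {subset S <= H} -> x \in H >].

Definition generates : Prop := forall x : G, x \in generated.

Lemma sub_generated : {subset S <= generated}.
Proof. by move=> x Sx; apply/asboolP => H _; apply. Qed.

Lemma generated_closed : group_closed generated.
Proof.
split=> [|x y /asboolP gx /asboolP gy]; apply/asboolP => H gH sSH.
  by have [] := gH.
by have [_ HV] := gH; apply: HV; [apply: gx | apply: gy].
Qed.

Definition generated_group : Type := {x : G | x \in generated}.

HB.instance Definition _ := SubType.on generated_group.
HB.instance Definition _ := Choice.on generated_group.
HB.instance Definition _ :=
  SubChoice_isSubGroup.Build G generated generated_group generated_closed.

End Generation.

Section Presentation.
Variable X : choiceType.

(* The letter [(true, x)] stands for the generator [x], and [(false, x)] for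
   its formal inverse. *)
Definition word : Type := seq (bool * X).

Definition inv_word (u : word) : word := rev [seq (~~ l.1, l.2) | l <- u].

Variable r : word -> word -> Prop.

Inductive pres_eq : word -> word -> Prop :=
| pres_refl u : pres_eq u u
| pres_sym u v : pres_eq u v -> pres_eq v u
| pres_trans v u w : pres_eq u v -> pres_eq v w -> pres_eq u w
| pres_ctx w1 w2 u v : pres_eq u v -> pres_eq (w1 ++ u ++ w2) (w1 ++ v ++ w2)
| pres_cancel b x : pres_eq [:: (b, x); (~~ b, x)] [::]
| pres_rel u v : r u v -> pres_eq u v.

Definition pres_eqb (u v : word) : bool := `[< pres_eq u v >].

Lemma pres_eqb_refl : reflexive pres_eqb.
Proof. by move=> u; apply/asboolP; apply: pres_refl. Qed.

Lemma pres_eqb_sym : symmetric pres_eqb.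
Proof. by move=> u v; apply/asboolP/asboolP => /pres_sym. Qed.

Lemma pres_eqb_trans : transitive pres_eqb.
Proof.
by move=> v u w /asboolP uv /asboolP vw; apply/asboolP; apply: pres_trans uv vw.
Qed.

Canonical pres_equiv_rel :=
  EquivRel pres_eqb pres_eqb_refl pres_eqb_sym pres_eqb_trans.

Definition presented : Type := {eq_quot pres_equiv_rel}%qT.

HB.instance Definition _ := Choice.on presented.
HB.instance Definition _ := EqQuotient.on presented.

Definition pres_class (u : word) : presented := \pi_presented%qT u.
Definition pres_gen (x : X) : presented := pres_class [:: (true, x)].

Lemma pres_classP u v : pres_class u = pres_class v <-> pres_eq u v.
Proof.
by split=> [/eqmodP/asboolP //|uv]; apply/eqmodP/asboolP.
Qed.

Lemma pres_repr u : pres_eq (repr (pres_class u)) u.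
Proof. by apply/pres_classP; rewrite /pres_class reprK. Qed.

Lemma pres_cat u u' v v' :
  pres_eq u u' -> pres_eq v v' -> pres_eq (u ++ v) (u' ++ v').
Proof.
move=> uu' vv'; apply: (@pres_trans (u' ++ v)).
  exact: (@pres_ctx [::] v _ _ uu').
by have := @pres_ctx u' [::] _ _ vv'; rewrite !cats0.
Qed.

Lemma pres_catV u : pres_eq (inv_word u ++ u) [::].
Proof.
elim: u => [|[b x] u IHu]; first exact: pres_refl.
rewrite /inv_word /= rev_cons -cats1 -catA.
apply: pres_trans IHu.
have := @pres_ctx (inv_word u) u _ _ (pres_cancel (~~ b) x).
by rewrite negbK.
Qed.

Lemma inv_wordK : involutive inv_word.
Proof.
move=> u; rewrite /inv_word map_rev revK -map_comp -[RHS]map_id.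
by apply: eq_map => -[b x] /=; rewrite negbK.
Qed.

Lemma pres_inv u v : pres_eq u v -> pres_eq (inv_word u) (inv_word v).
Proof.
move=> uv; apply: (@pres_trans (inv_word u ++ v ++ inv_word v)).
  rewrite -[X in pres_eq X]cats0; apply: pres_cat; first exact: pres_refl.
  by apply: pres_sym; have := pres_catV (inv_word v); rewrite inv_wordK.
rewrite catA -[X in pres_eq _ X]cat0s; apply: pres_cat; last exact: pres_refl.
apply: pres_trans (pres_catV u); apply: pres_cat; first exact: pres_refl.
exact: pres_sym.
Qed.

Definition pres_mul (x y : presented) := pres_class (repr x ++ repr y).
Definition pres_one := pres_class [::].
Definition pres_invg (x : presented) := pres_class (inv_word (repr x)).

Lemma pres_mulE u v :
  pres_mul (pres_class u) (pres_class v) = pres_class (u ++ v).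
Proof. by apply/pres_classP; apply: pres_cat; apply: pres_repr. Qed.

Lemma pres_invE u : pres_invg (pres_class u) = pres_class (inv_word u).
Proof. by apply/pres_classP; apply/pres_inv/pres_repr. Qed.

Lemma pres_classK x : pres_class (repr x) = x.
Proof. by rewrite /pres_class reprK. Qed.

Lemma pres_mulA : associative pres_mul.
Proof.
move=> x y z; rewrite -[x]pres_classK -[y]pres_classK -[z]pres_classK.
by rewrite !pres_mulE catA.
Qed.

Lemma pres_mul1 : left_id pres_one pres_mul.
Proof. by move=> x; rewrite -[x]pres_classK pres_mulE. Qed.

Lemma pres_mulg1 : right_id pres_one pres_mul.
Proof. by move=> x; rewrite -[x]pres_classK pres_mulE cats0. Qed.

Lemma pres_mulV : left_inverse pres_one pres_invg pres_mul.
Proof.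
move=> x; rewrite -[x]pres_classK pres_invE pres_mulE.
by apply/pres_classP/pres_catV.
Qed.

Lemma pres_mulgV : right_inverse pres_one pres_invg pres_mul.
Proof.
move=> x; rewrite -[x]pres_classK pres_invE pres_mulE.
by apply/pres_classP; rewrite -{1}[repr x]inv_wordK; apply: pres_catV.
Qed.

HB.instance Definition _ := isGroup.Build presented
  pres_mulA pres_mul1 pres_mulg1 pres_mulV pres_mulgV.

Section Lift.
Local Open Scope group_scope.
Variables (G : groupType) (f : X -> G).

Definition eval_letter (l : bool * X) : G := if l.1 then f l.2 else (f l.2)^-1.

Definition eval_word (u : word) : G := \prod_(l <- u) eval_letter l.

Definition pres_lift (x : presented) : G := eval_word (repr x).

Hypothesis f_rel : forall u v, r u v -> eval_word u = eval_word v.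

Lemma eval_pres_eq u v : pres_eq u v -> eval_word u = eval_word v.
Proof.
elim=> // {u v} [v u w _ -> _ -> //|w1 w2 u v _|b x].
  by rewrite /eval_word !big_cat /= => ->.
rewrite /eval_word !big_cons big_nil mulg1 /eval_letter.
by case: b => /=; rewrite ?mulgV ?mulVg.
Qed.

Lemma pres_lift_class u : pres_lift (pres_class u) = eval_word u.
Proof. exact/eval_pres_eq/pres_repr. Qed.

Lemma pres_lift_gen x : pres_lift (pres_gen x) = f x.
Proof. by rewrite pres_lift_class /eval_word big_seq1. Qed.

Lemma pres_liftM : {morph pres_lift : x y / x * y}.
Proof.
move=> x y; rewrite -[x]pres_classK -[y]pres_classK.
rewrite [_ * _]pres_mulE !pres_lift_class.
by rewrite /eval_word big_cat.
Qed.

End Lift.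

End Presentation.

(* [qact a b] is [^a b]. *)
HB.mixin Record isIPQuandle C of Choice C := {
  qact : C -> C -> C;
  qinv : C -> C;
  qactA : forall a b c, qact a (qact b c) = qact (qact a b) (qact a c);
  qact_bij : forall a, bijective (qact a);
  qact_idem : forall a, qact a a = a;
  qinvK : involutive qinv;
  qactV : forall a b, qact a (qinv b) = qinv (qact a b);
  qact_invK : forall a b, qact (qinv a) (qact a b) = b
}.

#[short(type="ipQuandleType")]
HB.structure Definition IPQuandle := {C of isIPQuandle C & Choice C}.

Section StructureGroup.
Variable C : ipQuandleType.

Inductive quandle_rel : word C -> word C -> Prop :=
| quandle_rel_conj a b :
    quandle_rel [:: (true, qact a b); (true, a)] [:: (true, a); (true, b)]
| quandle_rel_inv a : quandle_rel [:: (true, qinv a); (true, a)] [::].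

Definition quandle_group : groupType := presented quandle_rel.

End StructureGroup.

(* With this definition the empty graph is connected. *)
Definition graph_connected (T : eqType) (V : {pred T}) (e : rel T) : Prop :=
  {in V &, forall x y,
    exists p : seq T, [/\ all [in V] p, path e x p & last x p = y]}.

Definition mutually_skew (C : ipQuandleType) : rel C :=
  fun a b => qact a b == qinv (qact b a).

Definition locally_skew (C : ipQuandleType) : Prop :=
  graph_connected predT (fun a b : C => (a != b) && mutually_skew a b).

Section Covering.
Local Open Scope group_scope.

Record quandle_set (G : groupType) := QuandleSet {
  qset :> {pred G};
  qset1 : 1 \notin qset;
  qsetJ : forall g a, a \in qset -> g * a * g^-1 \in qset;
  qsetV : forall a, a \in qset -> a^-1 \in qset
}.

Variables (G : groupType) (C : quandle_set G).

Definition quandle_of : Type := {a : G | a \in qset C}.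

HB.instance Definition _ := SubType.on quandle_of.
HB.instance Definition _ := Choice.on quandle_of.

Definition conj_qact (a b : quandle_of) : quandle_of :=
  Sub (val a * val b * (val a)^-1) (qsetJ (val a) (valP b)).
Definition conj_qinv (a : quandle_of) : quandle_of :=
  Sub (val a)^-1 (qsetV (valP a)).

Lemma conj_qactA a b c :
  conj_qact a (conj_qact b c) = conj_qact (conj_qact a b) (conj_qact a c).
Proof. by apply: val_inj; rewrite /= !invgM !invgK !mulgA !mulgVK. Qed.

Lemma conj_qact_idem a : conj_qact a a = a.
Proof. by apply: val_inj; rewrite /= mulgK. Qed.

Lemma conj_qinvK : involutive conj_qinv.
Proof. by move=> a; apply: val_inj; rewrite /= invgK. Qed.

Lemma conj_qactV a b : conj_qact a (conj_qinv b) = conj_qinv (conj_qact a b).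
Proof. by apply: val_inj; rewrite /= !invgM invgK mulgA. Qed.

Lemma conj_qact_invK a b : conj_qact (conj_qinv a) (conj_qact a b) = b.
Proof. by apply: val_inj; rewrite /= invgK !mulgA mulVg mul1g mulgVK. Qed.

Lemma conj_qact_bij a : bijective (conj_qact a).
Proof.
exists (conj_qact (conj_qinv a)) => b; first exact: conj_qact_invK.
by rewrite -{1}[a]conj_qinvK conj_qact_invK.
Qed.

HB.instance Definition _ := isIPQuandle.Build quandle_of conj_qactA
  conj_qact_bij conj_qact_idem conj_qinvK conj_qactV conj_qact_invK.

Definition canonical_map : quandle_group quandle_of -> G :=
  @pres_lift quandle_of _ G val.

Lemma val_quandle_rel u v :
  @quandle_rel quandle_of u v -> eval_word val u = eval_word val v :> G.
Proof.
case=> [a b|a]; rewrite /eval_word !(big_cons, big_nil) /eval_letter /= !mulg1.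
  by rewrite mulgVK.
by rewrite mulVg.
Qed.

Lemma canonical_map_gen a : canonical_map (pres_gen _ a) = val a.
Proof. exact: (pres_lift_gen val_quandle_rel). Qed.

Lemma canonical_mapM : {morph canonical_map : x y / x * y}.
Proof. exact: (pres_liftM val_quandle_rel). Qed.

Definition covering_group : Prop := generates C /\ bijective canonical_map.

End Covering.

Local Open Scope ring_scope.
Local Open Scope fset_scope.

Section Weyl.
Variables (R : realType) (n : nat).
Implicit Types (u v a b : 'cV[R]_n) (Phi Delta : {fset 'cV[R]_n}).

Definition dot u v : R := (u^T *m v) 0 0.

Lemma dotE u v : dot u v = \sum_i u i 0 * v i 0.
Proof. by rewrite /dot mxE; apply: eq_bigr => i _; rewrite mxE. Qed.

Lemma dot_gt0 v : v != 0 -> 0 < dot v v.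
Proof.
move=> v0; rewrite lt_def dotE; apply/andP; split; last first.
  by apply: sumr_ge0 => i _; rewrite -expr2 sqr_ge0.
apply: contra_neq v0 => /eqP; rewrite psumr_eq0 => [|i _]; last first.
  by rewrite -expr2 sqr_ge0.
move=> /allP v0; apply/colP => i; rewrite mxE.
by have := v0 i (mem_index_enum i); rewrite mulf_eq0 orbb => /eqP.
Qed.

Definition orthogonal : {pred 'M[R]_n} := fun A => A^T *m A == 1%:M.

Definition orthogonal_group : Type := {A : 'M[R]_n | A \in orthogonal}.

HB.instance Definition _ := SubType.on orthogonal_group.
HB.instance Definition _ := Choice.on orthogonal_group.

Lemma orthogonalM A B :
  A \in orthogonal -> B \in orthogonal -> A *m B \in orthogonal.
Proof.
rewrite !unfold_in => /eqP AA /eqP BB.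
by rewrite trmx_mul mulmxA -(mulmxA B^T) AA mulmx1 BB.
Qed.

Lemma orthogonal1 : 1%:M \in orthogonal.
Proof. by rewrite unfold_in trmx1 mulmx1. Qed.

Lemma orthogonalV A : A \in orthogonal -> A^T \in orthogonal.
Proof. by rewrite !unfold_in trmxK => /eqP/mulmx1C ->. Qed.

Definition orth_mul (A B : orthogonal_group) : orthogonal_group :=
  Sub (val A *m val B) (orthogonalM (valP A) (valP B)).
Definition orth_one : orthogonal_group := Sub 1%:M orthogonal1.
Definition orth_inv (A : orthogonal_group) : orthogonal_group :=
  Sub (val A)^T (orthogonalV (valP A)).

Lemma orth_mulA : associative orth_mul.
Proof. by move=> A B C; apply: val_inj; rewrite /= mulmxA. Qed.

Lemma orth_mul1g : left_id orth_one orth_mul.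
Proof. by move=> A; apply: val_inj; rewrite /= mul1mx. Qed.

Lemma orth_mulg1 : right_id orth_one orth_mul.
Proof. by move=> A; apply: val_inj; rewrite /= mulmx1. Qed.

Lemma orth_mulVg : left_inverse orth_one orth_inv orth_mul.
Proof. by move=> A; apply: val_inj; rewrite /=; apply/eqP: (valP A). Qed.

Lemma orth_mulgV : right_inverse orth_one orth_inv orth_mul.
Proof.
by move=> A; apply: val_inj; rewrite /=; apply: mulmx1C; apply/eqP: (valP A).
Qed.

HB.instance Definition _ := isGroup.Build orthogonal_group
  orth_mulA orth_mul1g orth_mulg1 orth_mulVg orth_mulgV.

(* The pairing of [b] with the coroot of [a]. *)
Definition cartan b a : R := 2 * dot b a / dot a a.

Definition reflect a v : 'cV[R]_n := v - cartan v a *: a.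

Definition reflection_mx a : 'M[R]_n := 1%:M - (2 / dot a a) *: (a *m a^T).

Lemma reflection_mxE a v : reflection_mx a *m v = reflect a v.
Proof.
rewrite /reflection_mx /reflect /cartan mulmxBl mul1mx -scalemxAl -mulmxA.
rewrite [a^T *m v]mx11_scalar mul_mx_scalar scalerA; congr (_ - _ *: _).
by rewrite -/(dot a v) mulrAC; congr (_ * _ / _); rewrite !dotE;
  apply: eq_bigr => i _; rewrite mulrC.
Qed.

Definition is_reflection (g : orthogonal_group) : Prop :=
  exists2 a, a != 0 & val g = reflection_mx a.

(* Reduced crystallographic root systems; as in the theory of reflection groups,
   [Phi] is not required to span the ambient Euclidean space. *)
Record root_system Phi : Prop := RootSystem {
  root_neq0 : 0 \notin Phi;
  root_reduced : forall a c, a \in Phi -> c *: a \in Phi -> c = 1 \/ c = -1;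
  root_reflect : forall a b, a \in Phi -> b \in Phi -> reflect a b \in Phi;
  root_crystal : forall a b, a \in Phi -> b \in Phi ->
    cartan b a \is a Num.int
}.

Definition root_reflections Phi : {pred orthogonal_group} :=
  fun g => `[< exists2 a, a \in Phi & val g = reflection_mx a >].

Definition weyl_group Phi : groupType := generated_group (root_reflections Phi).

Definition weyl_reflection Phi : {pred weyl_group Phi} :=
  fun w => `[< is_reflection (val w) >].
Arguments weyl_reflection : clear implicits.

Lemma cartan_id a : a != 0 -> cartan a a = 2.
Proof. by move=> /dot_gt0/gt_eqF/negbT aa; rewrite /cartan mulfK. Qed.

Lemma reflection_mxN1 a : a != 0 -> reflection_mx a != 1%:M.
Proof.
move=> a0; apply/eqP => /(congr1 (mulmx^~ a)); rewrite mul1mx reflection_mxE.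
rewrite /reflect cartan_id // => /eqP.
rewrite subr_eq -[X in X == _]addr0 (inj_eq (addrI a)) eq_sym scaler_eq0.
by rewrite (negPf a0) pnatr_eq0.
Qed.

Lemma reflection_mxV a : (reflection_mx a)^T = reflection_mx a.
Proof. by rewrite /reflection_mx linearB /= trmx1 linearZ /= trmx_mul trmxK. Qed.

Lemma reflection_mxJ (A : 'M[R]_n) a : A \in orthogonal ->
  A *m reflection_mx a *m A^T = reflection_mx (A *m a).
Proof.
rewrite unfold_in => /eqP AA; have /mulmx1C AA' := AA.
rewrite /reflection_mx mulmxBr mulmxBl mulmx1 AA' -scalemxAr -scalemxAl.
have -> : dot (A *m a) (A *m a) = dot a a.
  by rewrite /dot trmx_mul mulmxA -(mulmxA a^T) AA mulmx1.
by rewrite trmx_mul !mulmxA.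
Qed.

Lemma weyl_reflection1 Phi : (1%g : weyl_group Phi) \notin weyl_reflection Phi.
Proof.
apply/negP => /asboolP[a a0] /esym/eqP.
by rewrite (negPf (reflection_mxN1 a0)).
Qed.

Lemma weyl_reflectionJ Phi (g w : weyl_group Phi) :
  w \in weyl_reflection Phi -> (g * w * g^-1)%g \in weyl_reflection Phi.
Proof.
move=> /asboolP[a a0 wa]; apply/asboolP; exists (val (val g) *m a).
  apply: contra_neq a0 => ga0; have /eqP gg := valP (val g).
  by rewrite -[a]mul1mx -gg -mulmxA ga0 mulmx0.
by rewrite -(reflection_mxJ _ (valP (val g))) -wa.
Qed.

Lemma weyl_reflectionV Phi (w : weyl_group Phi) :
  w \in weyl_reflection Phi -> (w^-1)%g \in weyl_reflection Phi.
Proof.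
move=> /asboolP[a a0 wa]; apply/asboolP; exists a => //.
by rewrite -reflection_mxV -wa.
Qed.

Definition reflections Phi : quandle_set (weyl_group Phi) :=
  QuandleSet (@weyl_reflection1 Phi) (@weyl_reflectionJ Phi)
    (@weyl_reflectionV Phi).

(* The set of simple roots, that is of vertices of the Dynkin diagram. *)
Record base Phi Delta : Prop := Base {
  base_sub : Delta `<=` Phi;
  base_free : free Delta;
  base_span : forall b, b \in Phi -> exists c : 'cV[R]_n -> nat,
    b = \sum_(a <- Delta) (c a)%:R *: a \/
    b = - \sum_(a <- Delta) (c a)%:R *: a
}.

(* The number of edges joining two distinct vertices [a] and [b] of the Dynkin
   diagram, that is [4 * cos ^ 2] of the angle between them. *)
Definition dynkin_edges a b : R := cartan a b * cartan b a.

Definition simply_laced Delta : Prop :=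
  {in Delta &, forall a b, a != b -> dynkin_edges a b <= 1}.

Definition dynkin_connected Delta : Prop :=
  graph_connected [in Delta] (fun a b => (a != b) && (dynkin_edges a b != 0)).

End Weyl.

(* Main.v *)
Require Import Defs.
From mathcomp Require Import all_boot all_order all_algebra.
From mathcomp Require Import finmap boolp reals.
From mathcomp Require Import ring lra zify.
(* Restores the geometric meaning of [reflect] and [orthogonal]. *)
Import Defs.

(** Let [GC] be the group presented by the reflections of the Weyl group [W].
   Conjugation in [GC] is visible in [W]: if [x b] is the generator attached to
   the reflection in a root [b], then [g * x b * g^-1 = x (g b)], where [g] acts
   through its image in [W] ([lift_reflectionJ]). This is what makes the usual
   deletion argument for [W] work in [GC] itself. Fix a base. Every root is
   reached from a simple one by simple reflections ([root_ind]), so every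
   element of [GC] is a word in the [x a], [a] simple. If a nonempty word
   sends all simple roots to positive roots, follow its last letter [a]: the
   root [a] is first turned negative, hence must become positive again at some
   letter [c], and since the reflection in a simple root [c] changes the sign of
   no root but [c] and [- c], the subword [u] between the two letters satisfies
   [u a = c]. The conjugation rule then gives [u * x a = x c * u] in [GC], and
   both letters can be deleted because [x c * x c = 1]. By induction on the
   length the word is trivial in [GC] ([pos_preserving_eq1]), so that
   [GC -> W] is injective.

   The generators of [GC] are all elements of [W] that are reflections of the
   Euclidean space, so one also needs that these are reflections in roots
   ([weyl_reflection_root]). If a reflection of [W] in a vector [a] is not a
   root reflection, some vector [v] orthogonal to [a] is orthogonal to no root
   ([generic_orthogonal]). This [v] defines a base ([regular_base]) whose
   positive roots are preserved by the reflection, which is then trivial by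
   [pos_preserving_eq1] applied to [W]: a contradiction.

   For the second part, the reflections in roots [a] and [b] are mutually skew
   exactly when [reflect b a = +- reflect a b] ([mutually_skewP]). Comparing
   norms, [a] and [b] then have the same length; in a locally skew quandle all
   roots thus have the same length, which by integrality rules out multiple
   edges. Conversely, neighbours in a simply laced diagram are mutually skew,
   so the simple reflections of a connected diagram are joined by skew paths.
   Conjugation respects skewness, and conjugating a path that ends at the simple
   reflection [s] by [s] keeps its end point, so [root_ind] extends
   connectedness to all reflections. *)

Set Implicit Arguments.
Unset Strict Implicit.
Unset Printing Implicit Defensive.

Import Order.TTheory GRing.Theory Num.Theory.
Local Open Scope ring_scope.

(** * Euclidean geometry of reflections *)

Section Euclidean.
Variables (R : realType) (n : nat).
Implicit Types (u v a b : 'cV[R]_n) (A B : 'M[R]_n).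

Lemma dotC u v : dot u v = dot v u.
Proof. by rewrite !dotE; apply: eq_bigr => i _; rewrite mulrC. Qed.

Lemma dotDr u v w : dot u (v + w) = dot u v + dot u w.
Proof. by rewrite /dot mulmxDr mxE. Qed.

Lemma dotZr k u v : dot u (k *: v) = k * dot u v.
Proof. by rewrite /dot -scalemxAr mxE. Qed.

Lemma dotNr u v : dot u (- v) = - dot u v.
Proof. by rewrite -scaleN1r dotZr mulN1r. Qed.

Lemma dotBr u v w : dot u (v - w) = dot u v - dot u w.
Proof. by rewrite dotDr dotNr. Qed.

Lemma dot0r u : dot u 0 = 0.
Proof. by rewrite -(scale0r 0) dotZr mul0r. Qed.

Lemma dotDl u v w : dot (u + v) w = dot u w + dot v w.
Proof. by rewrite dotC dotDr !(dotC w). Qed.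

Lemma dotZl k u v : dot (k *: u) v = k * dot u v.
Proof. by rewrite dotC dotZr dotC. Qed.

Lemma dotNl u v : dot (- u) v = - dot u v.
Proof. by rewrite dotC dotNr dotC. Qed.

Lemma dotBl u v w : dot (u - v) w = dot u w - dot v w.
Proof. by rewrite dotDl dotNl. Qed.

Lemma dot_sumr (I : Type) (s : seq I) (P : pred I) (F : I -> 'cV[R]_n) u :
  dot u (\sum_(i <- s | P i) F i) = \sum_(i <- s | P i) dot u (F i).
Proof. exact: (big_morph (dot u) (dotDr u) (dot0r u)). Qed.

Lemma dot_suml (I : Type) (s : seq I) (P : pred I) (F : I -> 'cV[R]_n) u :
  dot (\sum_(i <- s | P i) F i) u = \sum_(i <- s | P i) dot (F i) u.
Proof. by rewrite dotC dot_sumr; apply: eq_bigr => i _; rewrite dotC. Qed.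

Lemma dot_orthogonal A u v : A \in @orthogonal R n ->
  dot (A *m u) (A *m v) = dot u v.
Proof.
by rewrite unfold_in => /eqP AA;
  rewrite /dot trmx_mul mulmxA -(mulmxA u^T) AA mulmx1.
Qed.

Lemma mulmx_ext A B : (forall v, A *m v = B *m v) -> A = B.
Proof.
move=> AB; apply/matrixP => i j.
by have /(congr1 (fun M : 'cV_n => M i 0)) := AB (delta_mx j 0);
  rewrite -!colE !mxE.
Qed.

Lemma cartanDl b c a : cartan (b + c) a = cartan b a + cartan c a.
Proof. by rewrite /cartan dotDl mulrDr mulrDl. Qed.

Lemma cartanZl k b a : cartan (k *: b) a = k * cartan b a.
Proof. by rewrite /cartan dotZl mulrCA -!mulrA. Qed.

Lemma reflect_id a : a != 0 -> reflect a a = - a.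
Proof.
by move=> a0; rewrite /reflect cartan_id // scaler_nat mulr2n opprD addrA subrr
  add0r.
Qed.

Lemma cartan_reflect a v : a != 0 -> cartan (reflect a v) a = - cartan v a.
Proof.
move=> a0; rewrite /reflect -scaleNr cartanDl cartanZl cartan_id //.
by rewrite mulr_natr mulr2n addrA subrr add0r.
Qed.

Lemma reflectK a : a != 0 -> involutive (reflect a).
Proof.
move=> a0 v; rewrite {1}/reflect cartan_reflect // scaleNr opprK.
by rewrite /reflect subrK.
Qed.

Lemma reflection_mxN a : reflection_mx (- a) = reflection_mx a.
Proof.
by rewrite /reflection_mx dotNl dotNr opprK linearN /= mulmxN mulNmx opprK.
Qed.

Lemma reflection_mxZ k a : k != 0 -> reflection_mx (k *: a) = reflection_mx a.
Proof.
move=> k0; rewrite /reflection_mx dotZl dotZr [(k *: a)^T]linearZ /= -scalemxAr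
  -scalemxAl !scalerA.
have [->|a0] := eqVneq a 0; first by rewrite trmx0 mulmx0 !scaler0.
congr (_ - _ *: _); have := dot_gt0 a0; move/gt_eqF/negbT => aa.
by field; rewrite k0 aa.
Qed.

Lemma reflection_mxK a : a != 0 -> reflection_mx a *m reflection_mx a = 1%:M.
Proof.
move=> a0; apply: mulmx_ext => v.
by rewrite -mulmxA !reflection_mxE reflectK // mul1mx.
Qed.

Lemma reflection_orthogonal a : a != 0 -> reflection_mx a \in @orthogonal R n.
Proof. by move=> a0; rewrite unfold_in reflection_mxV reflection_mxK. Qed.

Lemma dot_reflect a v w : a != 0 -> dot (reflect a v) (reflect a w) = dot v w.
Proof.
by move=> a0; rewrite -!reflection_mxE dot_orthogonal ?reflection_orthogonal.
Qed.

(** Avoiding one more hyperplane: move the vector found so far along the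
   component of the new [b] orthogonal to [a]. Each condition excludes the roots
   of a nonzero polynomial of degree at most 1 in the parameter. *)
Lemma generic_orthogonal a (s : seq 'cV[R]_n) :
  (forall b, b \in s -> forall k, b != k *: a) ->
  exists v, dot v a = 0 /\ forall b, b \in s -> dot v b != 0.
Proof.
elim: s => [|b s IHs] sa; first by exists 0; rewrite dotC dot0r; split.
have [v [va vs]] : exists v, dot v a = 0 /\ forall c, c \in s -> dot v c != 0.
  by apply: IHs => c cs; apply: sa; rewrite inE cs orbT.
pose u := b - (dot b a / dot a a) *: a.
have ua : dot u a = 0.
  rewrite /u dotBl dotZl; have [->|/dot_gt0/gt_eqF/negbT aa] := eqVneq a 0.
    by rewrite !dot0r mulr0 subr0.
  by rewrite divfK // subrr.
have ub : dot u b != 0.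
  rewrite (_ : dot u b = dot u u);
    last by rewrite [in RHS]/u dotBr dotZr ua mulr0 subr0.
  by apply/lt0r_neq0/dot_gt0; rewrite subr_eq0 sa ?mem_head.
pose p c := (dot v c)%:P + (dot u c) *: 'X : {poly R}.
have p_neq0 c : c \in b :: s -> p c != 0.
  rewrite inE => /predU1P[->|cs]; apply/eqP => /polyP.
    by move=> /(_ 1%N); rewrite coefD coefC coefZ coefX coef0 add0r mulr1;
      apply/eqP.
  by move=> /(_ 0%N); rewrite coefD coefC coefZ coefX coef0 mulr0 addr0;
    apply/eqP/vs.
pose q := \prod_(c <- b :: s) p c.
have q0 : q != 0 by rewrite prodf_seq_neq0; apply/allP => c /p_neq0.
have [t qt] : exists t, ~~ root q t.
  (* More candidates than the degree of [q] allows roots. *)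
  pose ts := [seq k%:R | k <- iota 0 (size q)] : seq R.
  have : ~~ all (root q) ts.
    apply/negP => /max_poly_roots; rewrite map_inj_uniq ?iota_uniq; last first.
      by move=> i j /eqP; rewrite eqr_nat => /eqP.
    by move=> /(_ q0 isT); rewrite size_map size_iota ltnn.
  by move=> /allPn[t _ ?]; exists t.
exists (v + t *: u); split; first by rewrite dotDl dotZl va ua mulr0 addr0.
move=> c cs; move: qt; rewrite /root horner_prod prodf_seq_neq0 =>
  /allP/(_ c cs) /=.
by rewrite /p !hornerE dotDl dotZl mulrC.
Qed.

End Euclidean.

(** * Positive roots relative to a base *)

Section Roots.
Variables (R : realType) (n : nat) (Phi : {fset 'cV[R]_n}).
Hypothesis hPhi : root_system Phi.
Implicit Types (u v a b : 'cV[R]_n).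

Lemma root_nonzero b : b \in Phi -> b != 0.
Proof. by move=> bP; apply: contraTneq bP => ->; exact: (root_neq0 hPhi). Qed.

Lemma rootN b : b \in Phi -> - b \in Phi.
Proof.
by move=> bP; rewrite -(reflect_id (root_nonzero bP));
  apply: (root_reflect hPhi).
Qed.

(** Here reducedness enters: a reflection determines its root up to a scalar
   only. *)
Lemma reflection_mx_root_inj a b : a \in Phi -> b \in Phi ->
  reflection_mx a = reflection_mx b -> b = a \/ b = - a.
Proof.
move=> aP bP /(congr1 (mulmx^~ a)); rewrite !reflection_mxE.
rewrite reflect_id ?root_nonzero // => ab.
have {ab} : (cartan a b / 2) *: b = a.
  apply: (@scalerI _ _ 2); first by rewrite pnatr_eq0.
  rewrite scalerA mulrC divfK ?pnatr_eq0 // scaler_nat mulr2n.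
  by rewrite -[X in _ = X + _]opprK ab /reflect opprB subrK.
move=> ab; have := aP; rewrite -{1}ab => /(root_reduced hPhi bP)[k1|k1].
  by left; rewrite -ab k1 scale1r.
by right; rewrite -ab k1 scaleN1r opprK.
Qed.

Section Coordinates.
Variable Delta : {fset 'cV[R]_n}.
Hypothesis hD : base Phi Delta.

(** Written as a sum over positions in [Delta], with a single term, so that it
   is total in [a] and evidently linear in [v]. *)
Definition simple_coord a v : R :=
  \sum_(i < size (Delta : seq _) | (Delta : seq _)`_i == a)
     coord (in_tuple Delta) i v.

Definition pos_root b := forall a, a \in Delta -> 0 <= simple_coord a b.

Lemma simple_coordD a u v :
  simple_coord a (u + v) = simple_coord a u + simple_coord a v.
Proof. by rewrite -big_split; apply: eq_bigr => i _; rewrite linearD. Qed.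

Lemma simple_coordZ a k v : simple_coord a (k *: v) = k * simple_coord a v.
Proof.
by rewrite /simple_coord mulr_sumr; apply: eq_bigr => i _; rewrite linearZ.
Qed.

Lemma simple_coordN a v : simple_coord a (- v) = - simple_coord a v.
Proof. by rewrite -scaleN1r simple_coordZ mulN1r. Qed.

Lemma simple_coord_sum a (k : 'cV[R]_n -> R) : a \in Delta ->
  simple_coord a (\sum_(b <- Delta) k b *: b) = k a.
Proof.
move=> aD; have Duniq := fset_uniq Delta.
have ia : (index a Delta < size Delta)%N by rewrite index_mem.
rewrite /simple_coord (big_pred1 (Ordinal ia)) => [|i]; last first.
  by rewrite -{1}(nth_index 0 aD) nth_uniq.
rewrite (big_nth 0) big_mkord.
have := @coord_sum_free _ _ _ (in_tuple Delta) (fun i => k (Delta : seq _)`_i).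
by move/(_ (Ordinal ia) (base_free hD)) => /= ->; rewrite nth_index.
Qed.

Lemma simple_coord_simple a b : a \in Delta -> b \in Delta ->
  simple_coord a b = (b == a)%:R.
Proof.
move=> aD bD; rewrite -(simple_coord_sum (fun c => (b == c)%:R) aD).
rewrite (big_fsetD1 b) //= eqxx scale1r big_seq_cond big1 ?addr0 // => c.
by rewrite !inE andbT => /andP[/negPf cb _]; rewrite eq_sym cb scale0r.
Qed.

Lemma root_coordE b : b \in Phi -> b = \sum_(a <- Delta) simple_coord a b *: a.
Proof.
move=> /(base_span hD)[c bE].
have [k bk] : exists k : 'cV[R]_n -> R, b = \sum_(a <- Delta) k a *: a.
  case: bE => ->; first by exists (fun a => (c a)%:R).
  by exists (fun a => - (c a)%:R); rewrite -sumrN; apply: eq_bigr => a _;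
    rewrite scaleNr.
rewrite [LHS]bk [LHS]big_seq [RHS]big_seq; apply: eq_bigr => a aD.
by rewrite bk simple_coord_sum.
Qed.

Lemma root_posVneg b : b \in Phi -> pos_root b \/ pos_root (- b).
Proof.
move=> /(base_span hD)[c [->|->]]; [left | right; rewrite opprK];
  by move=> a aD; rewrite (simple_coord_sum (fun a => (c a)%:R)) // ler0n.
Qed.

Lemma pos_rootN b : b \in Phi -> pos_root b -> ~ pos_root (- b).
Proof.
move=> bP bpos bneg; have /eqP[] := root_nonzero bP.
rewrite (root_coordE bP) big_seq big1 // => a aD.
suff -> : simple_coord a b = 0 by rewrite scale0r.
by apply: le_anti; rewrite bpos // andbT -oppr_ge0 -simple_coordN bneg.
Qed.

Lemma simple_root a : a \in Delta -> a \in Phi.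
Proof. exact: (fsubsetP (base_sub hD)). Qed.

Lemma simple_pos a : a \in Delta -> pos_root a.
Proof. by move=> aD c cD; rewrite simple_coord_simple // ler0n. Qed.

(** A positive root [b] other than [a] has a positive coordinate along some
   other simple root; the reflection in [a] leaves it unchanged, and one
   positive coordinate makes a root positive. *)
Lemma simple_reflect_pos a b : a \in Delta -> b \in Phi -> pos_root b ->
  b != a -> pos_root (reflect a b).
Proof.
move=> aD bP bpos ba.
have [c [cD ca cb]] :
    exists c, [/\ c \in Delta, c != a & simple_coord c b != 0].
  apply: contrapT => noc.
  have bE : b = simple_coord a b *: a.
    rewrite [LHS]root_coordE // (big_fsetD1 a) //= big_seq_cond big1 ?addr0 //
      => c.
    rewrite !inE andbT => /andP[ca cD].
    have [->|cb] := eqVneq (simple_coord c b) 0.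
      by rewrite scale0r.
    by case: noc; exists c.
  have := bP; rewrite bE => /(root_reduced hPhi (simple_root aD))[k1|k1].
    by move: ba; rewrite bE k1 scale1r eqxx.
  by have := bpos a aD; rewrite k1 oppr_ge0 ler10.
have [//|/(_ c cD)] := root_posVneg (root_reflect hPhi (simple_root aD) bP).
rewrite simple_coordN /reflect simple_coordD simple_coordN simple_coordZ.
rewrite (simple_coord_simple cD aD) eq_sym (negPf ca) mulr0 subr0 oppr_ge0 =>
  cb_le0.
by move: cb; rewrite eq_le cb_le0 bpos.
Qed.

(** Otherwise [dot b b], expanded along the simple roots, would be at most 0. *)
Lemma pos_root_acute b : b \in Phi -> pos_root b ->
  exists2 a, a \in Delta & 0 < dot b a.
Proof.
move=> bP bpos; apply: contrapT => noa; have := dot_gt0 (root_nonzero bP).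
rewrite {2}(root_coordE bP) dot_sumr ltNge big_seq sumr_le0 // => a aD.
rewrite dotZr mulr_ge0_le0 ?bpos // leNgt.
by apply/negP => ?; apply: noa; exists a.
Qed.

(** Induction on the height: a positive root that is not simple makes an acute
   angle with some simple root, and reflecting it there gives a positive root
   whose height has dropped by a positive integer. *)
Lemma root_ind (P : 'cV[R]_n -> Prop) :
    (forall a, a \in Delta -> P a) ->
    (forall b, P b -> P (- b)) ->
    (forall a b, a \in Delta -> b \in Phi -> P b -> P (reflect a b)) ->
  forall b, b \in Phi -> P b.
Proof.
move=> Psimple PN Preflect.
pose ht b := \sum_(a <- Delta) simple_coord a b.
suff posP m b : b \in Phi -> pos_root b -> ht b < m%:R -> P b.
  move=> b bP; wlog bpos : b bP / pos_root b => [Pb|].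
    have [|bneg] := root_posVneg bP; first exact: Pb.
    by rewrite -[b]opprK; apply/PN/Pb; rewrite ?rootN.
  apply: (posP (Num.bound (ht b)) b bP bpos).
  by apply: le_lt_trans (archi_boundP _); rewrite // /ht big_seq sumr_ge0.
elim: m b => [|m IHm] b bP bpos htb.
  by move: htb; rewrite ltNge /ht big_seq sumr_ge0.
have [a aD ba_gt0] := pos_root_acute bP bpos.
have aP := simple_root aD; have a0 := root_nonzero aP.
have [->|ba] := eqVneq b a; first exact: Psimple.
have k_ge1 : 1 <= cartan b a.
  have /intrP[k kE] := root_crystal hPhi aP bP.
  have : 0 < cartan b a by rewrite divr_gt0 ?dot_gt0 ?mulr_gt0.
  by rewrite kE ltr0z ler1z.
rewrite -[b](reflectK a0); apply: (Preflect) => //; first exact: root_reflect.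
apply: IHm; [exact: root_reflect | exact: simple_reflect_pos |].
suff htE : ht (reflect a b) = ht b - cartan b a.
  by rewrite htE; move: htb; rewrite -natr1; lra.
rewrite /ht (eq_bigr (fun c =>
  simple_coord c b - cartan b a * simple_coord c a)).
  rewrite sumrB -mulr_sumr; congr (_ - _).
  rewrite (big_fsetD1 a) //= simple_coord_simple // eqxx big_seq_cond big1
    ?addr0 ?mulr1 // => c.
  by rewrite !inE andbT => /andP[ca cD];
    rewrite simple_coord_simple // eq_sym (negPf ca).
by move=> c _; rewrite /reflect simple_coordD simple_coordN simple_coordZ.
Qed.

End Coordinates.
End Roots.

(** * Groups lifting the reflections act freely on chambers *)

(** A group [G] acting on the space through [rho], with an involution [x b] over
   each root reflection; these involutions generate [G] and are permuted under
   conjugation as the roots are. Both the Weyl group and the group presented by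
   its reflections are of this kind, and are treated together. *)
Section ReflectionLifts.
Local Open Scope group_scope.
Variables (R : realType) (n : nat) (Phi : {fset 'cV[R]_n}).
Hypothesis hPhi : root_system Phi.
Variables (G : groupType) (rho : G -> 'M[R]_n) (x : 'cV[R]_n -> G).
Hypothesis rho1 : rho 1 = 1%:M%R.
Hypothesis rhoM : forall g h, rho (g * h) = (rho g *m rho h)%R.
Hypothesis rho_lift : forall b, b \in Phi -> rho (x b) = reflection_mx b.
Hypothesis liftJ : forall g b, b \in Phi -> g * x b * g^-1 = x (rho g *m b)%R.
Hypothesis liftK : forall b, b \in Phi -> x b * x b = 1.
Hypothesis lift_gen : forall g, exists2 l : seq 'cV[R]_n,
  {subset l <= Phi} & g = \prod_(b <- l) x b.

Lemma lift_reflect a b : a \in Phi -> b \in Phi ->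
  x (reflect a b) = x a * x b * x a.
Proof.
move=> aP bP; rewrite -reflection_mxE -rho_lift // -liftJ //; congr (_ * _).
by apply: mulg1_eq; apply: liftK.
Qed.

Lemma liftN b : b \in Phi -> x (- b)%R = x b.
Proof.
by move=> bP; rewrite -(reflect_id (root_nonzero hPhi bP)) lift_reflect //
  liftK // mul1g.
Qed.

Lemma rho_root g b : b \in Phi -> (rho g *m b)%R \in Phi.
Proof.
have [l lP ->] := lift_gen g; elim: l lP b => [|c l IHl] lP b bP.
  by rewrite big_nil rho1 mul1mx.
have cP : c \in Phi by apply/lP/mem_head.
rewrite big_cons rhoM rho_lift // -mulmxA reflection_mxE root_reflect //.
by apply: IHl => // d dl; apply: lP; rewrite inE dl orbT.
Qed.

Section Base.
Variable Delta : {fset 'cV[R]_n}.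
Hypothesis hD : base Phi Delta.

Lemma lift_simple_word b : b \in Phi ->
  exists2 l : seq 'cV[R]_n, {subset l <= Delta} & x b = \prod_(a <- l) x a.
Proof.
suff : b \in Phi -> b \in Phi /\
    exists2 l : seq 'cV[R]_n, {subset l <= Delta} & x b = \prod_(a <- l) x a.
  by move=> H /H[].
move=> bP; elim/(root_ind hPhi hD): b / bP =>
  [a aD|b [bP [l lD bl]]|a b aD bP [_ [l lD bl]]].
- split; first exact: (simple_root hD).
  by exists [:: a]; rewrite ?big_seq1 // => c; rewrite inE => /eqP->.
- by split; [exact: rootN | exists l; rewrite // liftN].
- have aP := simple_root hD aD; split; first exact: root_reflect.
  exists (a :: rcons l a).
    by move=> c; rewrite inE mem_rcons inE => /predU1P[->|/predU1P[->|/lD]].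
  by rewrite lift_reflect // bl big_cons -cats1 big_cat /= big_seq1 mulgA.
Qed.

Lemma simple_word g :
  exists2 l : seq 'cV[R]_n, {subset l <= Delta} & g = \prod_(a <- l) x a.
Proof.
have [l lP ->] := lift_gen g; elim: l lP => [|b l IHl] lP.
  by exists [::]; rewrite ?big_nil.
have [l1 l1D bl1] := lift_simple_word (lP b (mem_head _ _)).
have [|l2 l2D ll2] := IHl; first by move=> c cl; apply: lP; rewrite inE cl orbT.
exists (l1 ++ l2); last by rewrite big_cons bl1 ll2 big_cat.
by move=> c; rewrite mem_cat => /orP[/l1D|/l2D].
Qed.

(** Read the word from right to left and stop at the letter [c] where the image
   of [b] first turns negative: that image was a positive root made negative
   by the simple reflection in [c], so it was [c] itself. *)
Lemma sign_change l b : {subset l <= Delta} -> b \in Phi -> pos_root Delta b ->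
    ~ pos_root Delta (rho (\prod_(a <- l) x a) *m b)%R ->
  exists l1 c l2, l = l1 ++ c :: l2 /\ (rho (\prod_(a <- l2) x a) *m b)%R = c.
Proof.
elim: l => [|c l IHl] lD bP bpos; first by rewrite big_nil rho1 mul1mx.
have cD := lD c (mem_head _ _); have cP := simple_root hD cD.
have {}lD : {subset l <= Delta} by move=> d dl; apply: lD; rewrite inE dl orbT.
have [lpos|lneg] := pselect (pos_root Delta (rho (\prod_(a <- l) x a) *m b)%R).
  rewrite big_cons rhoM rho_lift // -mulmxA reflection_mxE => clneg.
  exists [::], c, l; split=> //; apply: contrapT => /eqP lc; apply: clneg.
  exact: (simple_reflect_pos hPhi hD) (rho_root _ bP) _ _.
move=> _; have [l1 [d [l2 [-> <-]]]] := IHl lD bP bpos lneg.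
by exists (c :: l1), (rho (\prod_(a <- l2) x a) *m b)%R, l2.
Qed.

(** The deletion argument, carried out in [G]: a nonempty word in simple
   involutions preserving positivity can be shortened by two letters. *)
Lemma pos_preserving_eq1 g :
  (forall a, a \in Delta -> pos_root Delta (rho g *m a)%R) -> g = 1.
Proof.
have [l lD ->] := simple_word g.
have [m] := ubnP (size l); elim: m l lD => // m IHm l.
case/lastP: l => [|l a] lD sizel lpos; first by rewrite big_nil.
have aD : a \in Delta by apply: lD; rewrite mem_rcons mem_head.
have aP := simple_root hD aD.
have {}lD : {subset l <= Delta}.
  by move=> d dl; apply: lD; rewrite mem_rcons inE dl orbT.
have wE : \prod_(c <- rcons l a) x c = (\prod_(c <- l) x c) * x a.
  by rewrite -cats1 big_cat /= big_seq1.
have [|l1 [c [l2 [lE l2a]]]] := sign_change lD aP (simple_pos hD aD).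
  move=> la; have := lpos a aD;
    rewrite wE rhoM rho_lift // -mulmxA reflection_mxE.
  rewrite reflect_id ?(root_nonzero hPhi) // mulmxN.
  by apply: (pos_rootN hPhi hD) => //; apply: rho_root.
have cP : c \in Phi.
  by apply: (simple_root hD); apply: lD; rewrite lE mem_cat mem_head orbT.
have {}wE : \prod_(c <- rcons l a) x c = \prod_(c <- l1 ++ l2) x c.
  (* The word reads [l1, c, l2, a], and [l2] carries [a] to [c]. *)
  have /(congr1 (fun h => h * \prod_(b <- l2) x b)) :=
    liftJ (\prod_(b <- l2) x b) aP.
  rewrite mulgVK l2a => l2aE.
  rewrite wE lE !big_cat big_cons /= -!mulgA l2aE; congr (_ * _).
  by rewrite mulgA liftK // mul1g.
rewrite wE in lpos *; apply: IHm => //.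
  by move=> d; rewrite mem_cat => dl; apply: lD; rewrite lE mem_cat inE;
    case/orP: dl => ->; rewrite ?orbT.
by move: sizel; rewrite size_rcons lE !size_cat /= addnS !ltnS;
  apply: leq_trans; rewrite ltnS leqnSn.
Qed.

Lemma rho_inj g h : rho g = rho h -> g = h.
Proof.
move=> gh; apply/eqP; rewrite -[h]invgK -mulg_eq1; apply/eqP.
apply: pos_preserving_eq1 => a aD; rewrite rhoM gh -rhoM mulgV rho1 mul1mx.
exact: (simple_pos hD).
Qed.

End Base.
End ReflectionLifts.

(** * Existence of bases *)

Section RegularBase.
Variables (R : realType) (n : nat) (Phi : {fset 'cV[R]_n}).
Hypothesis hPhi : root_system Phi.
Implicit Types (u v a b : 'cV[R]_n).

(** In a linear relation, separate the positive and negative coefficients to get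
   one vector [u] written in two ways on disjoint sets of members of [X].
   Obtuseness gives [dot u u <= 0], so [u = 0], and pairing with [v] kills every
   coefficient. *)
Lemma obtuse_free v (X : seq 'cV[R]_n) : uniq X ->
    {in X, forall a, 0 < dot v a} ->
    {in X &, forall a b, a != b -> dot a b <= 0} ->
  free X.
Proof.
move=> Xuniq Xpos Xobtuse.
suff coef_le0 (k : 'I_(size X) -> R) :
    \sum_i k i *: X`_i = 0 -> forall i, k i <= 0.
  change (is_true (free (in_tuple X))); apply/freeP => k k0 i; apply: le_anti;
    rewrite coef_le0 //=.
  rewrite -oppr_le0; apply: (coef_le0 (fun i => - k i)).
  by rewrite -[RHS]oppr0 -[in RHS]k0 -sumrN; apply: eq_bigr => j _;
    rewrite scaleNr.
(* [p] and [q] are the positive and negative parts of [k]. *)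
move=> k0; pose p i := Num.max (k i) 0; pose q i := p i - k i.
have p_ge0 i : 0 <= p i by rewrite le_max lexx orbT.
have q_ge0 i : 0 <= q i by rewrite subr_ge0 le_max lexx.
have pq0 i : p i * q i = 0.
  by rewrite /q /p; case: leP => _; rewrite ?mul0r ?subrr ?mulr0.
pose u := \sum_i p i *: X`_i.
have uE : u = \sum_i q i *: X`_i.
  rewrite (eq_bigr (fun i => p i *: X`_i - k i *: X`_i)); last first.
    by move=> i _; rewrite scalerBl.
  by rewrite sumrB k0 subr0.
have u0 : u = 0.
  apply: contrapT => /eqP/dot_gt0; apply/negP; rewrite -leNgt.
  rewrite {2}uE dot_suml; apply: sumr_le0 => i _.
  rewrite dot_sumr; apply: sumr_le0 => j _.
  rewrite dotZl dotZr; have [->|ij] := eqVneq i j;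
    first by rewrite mulrA pq0 mul0r.
  by rewrite mulrA mulr_ge0_le0 ?mulr_ge0 ?Xobtuse ?mem_nth // nth_uniq.
move=> i; suff pi0 : p i = 0 by rewrite -[leRHS]pi0 le_max lexx.
have : dot v u == 0 by rewrite u0 dot0r.
rewrite dot_sumr psumr_eq0 => [|j _]; last first.
  by rewrite dotZr mulr_ge0 // ltW // Xpos // mem_nth.
move=> /allP/(_ i (mem_index_enum _)); rewrite dotZr mulf_eq0.
by case/orP => /eqP // vi; have := Xpos _ (mem_nth 0 (ltn_ord i));
  rewrite vi ltxx.
Qed.

(** If neither of the two Cartan integers were 1, both would be at least 2,
   which contradicts [0 < dot (a - b) (a - b)]; if one of them is 1, a
   reflection produces [a - b] up to sign. *)
Lemma root_sub a b : a \in Phi -> b \in Phi -> a != b ->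
  0 < dot a b -> a - b \in Phi.
Proof.
move=> aP bP ab ab_gt0.
have aa := dot_gt0 (root_nonzero hPhi aP).
have bb := dot_gt0 (root_nonzero hPhi bP).
have /intrP[k kE] := root_crystal hPhi bP aP.
have /intrP[m mE] := root_crystal hPhi aP bP.
have k_gt0 : 0 < k by rewrite -(ltr0z R) -kE divr_gt0 // mulr_gt0.
have m_gt0 : 0 < m by rewrite -(ltr0z R) -mE divr_gt0 // dotC mulr_gt0.
have [k1|k1] := eqVneq k 1.
  by have := root_reflect hPhi bP aP; rewrite /reflect kE k1 scale1r.
have [m1|m1] := eqVneq m 1.
  by have := rootN hPhi (root_reflect hPhi aP bP);
    rewrite /reflect mE m1 scale1r opprB.
have k_ge2 : 2 <= k%:~R :> R by rewrite (ler_int R 2); lia.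
have m_ge2 : 2 <= m%:~R :> R by rewrite (ler_int R 2); lia.
have : 0 < dot (a - b) (a - b) by rewrite dot_gt0 // subr_eq0.
have kab : 2 * dot a b = k%:~R * dot b b by rewrite -kE divfK // gt_eqF.
have mab : 2 * dot a b = m%:~R * dot a a by rewrite dotC -mE divfK // gt_eqF.
have : 2 * dot b b <= k%:~R * dot b b by rewrite ler_pM2r.
have : 2 * dot a a <= m%:~R * dot a a by rewrite ler_pM2r.
rewrite -kab -mab dotBl !dotBr (dotC b a); lra.
Qed.

(** The simple roots are those on the positive side of [v] which are not the sum
   of two others there. Two of them never make an acute angle, for
   otherwise their difference would be a root and one of them would decompose. *)
Lemma regular_base v : (forall b, b \in Phi -> dot v b != 0) ->
  exists2 Delta : {fset 'cV[R]_n},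
    base Phi Delta & forall a, a \in Delta -> 0 < dot v a.
Proof.
move=> vreg.
pose decomp a := exists b c,
  [/\ b \in Phi, c \in Phi, 0 < dot v b, 0 < dot v c & a = b + c].
pose Delta := [fset a in Phi | (0 < dot v a) && ~~ `[< decomp a >] ]%fset.
have DP a : a \in Delta -> [/\ a \in Phi, 0 < dot v a & ~ decomp a].
  by rewrite !inE /= => /and3P[aP va /asboolPn].
exists Delta; last by move=> a /DP[].
have posE b : b \in Phi -> 0 < dot v b ->
    exists c : 'cV[R]_n -> nat, b = \sum_(a <- Delta) (c a)%:R *: a.
  (* Summands of [b] have fewer roots below them with respect to [v]. *)
  pose below b := [fset c in Phi | dot v c < dot v b]%fset.
  have [m] := ubnP #|` below b|; elim: m b => // m IHm b bm bP vb.
  have [[c [d [cP dP vc vd bE]]]|bindec] := pselect (decomp b).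
    have below_lt e : e \in Phi -> dot v e < dot v b -> (#|` below e| < m)%N.
      move=> eP eb; apply: leq_trans (_ : #|` below b| <= m)%N; last exact: bm.
      apply: fproper_ltn_card; rewrite fproperE; apply/andP; split.
        by apply/fsubsetP => f; rewrite !inE /= => /andP[-> /= fe];
          apply: lt_trans eb.
      by apply/fsubsetPn; exists e; rewrite !inE /= eP ?ltxx.
    have [|f fE] := IHm c _ cP vc.
      by apply: below_lt => //; rewrite bE dotDr ltrDl.
    have [|g gE] := IHm d _ dP vd.
      by apply: below_lt => //; rewrite bE dotDr ltrDr.
    exists (fun a => f a + g a)%N; rewrite bE fE gE -big_split /=.
    by apply: eq_bigr => a _; rewrite natrD scalerDl.
  have bD : b \in Delta by rewrite !inE /= bP vb; apply/asboolPn.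
  exists (fun a => a == b); rewrite (big_fsetD1 b) //= eqxx scale1r.
  rewrite big_seq_cond big1 ?addr0 // => a.
  by rewrite !inE andbT => /andP[/negPf-> _]; rewrite scale0r.
split.
- by apply/fsubsetP => a /DP[].
- apply: (obtuse_free (fset_uniq Delta) (v := v)) => [a /DP[]//|a b aD bD ab].
  have [aP va aindec] := DP a aD; have [bP vb bindec] := DP b bD.
  rewrite leNgt; apply/negP => ab_gt0; have abP := root_sub aP bP ab ab_gt0.
  have [vab|vab|/eqP vab] := ltrgtP (dot v (a - b)) 0.
  + apply: bindec; exists a, (b - a); split=> //; last by rewrite addrC subrK.
      by rewrite -opprB rootN.
    by rewrite -opprB dotNr oppr_gt0.
  + by apply: aindec; exists b, (a - b); split=> //; rewrite addrC subrK.
  + by move: (vreg _ abP); rewrite vab.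
- move=> b bP; have [vb|vb|/eqP vb] := ltrgtP (dot v b) 0.
  + have [|c cE] := posE (- b) (rootN hPhi bP); first by rewrite dotNr oppr_gt0.
    by exists c; right; rewrite -cE opprK.
  + by have [c cE] := posE b bP vb; exists c; left.
  + by move: (vreg _ bP); rewrite vb.
Qed.

Lemma base_exists : exists Delta, base Phi Delta.
Proof.
have [|v [_ vreg]] := @generic_orthogonal R n 0 Phi.
  by move=> b bP k; rewrite scaler0 (root_nonzero hPhi).
by have [Delta hD _] := regular_base vreg; exists Delta.
Qed.

Lemma pos_root_regular v Delta b : base Phi Delta ->
    (forall a, a \in Delta -> 0 < dot v a) -> b \in Phi ->
  pos_root Delta b <-> 0 < dot v b.
Proof.
move=> hD vD; have pos_gt0 c : c \in Phi -> pos_root Delta c -> 0 < dot v c.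
  move=> cP cpos; have cE := root_coordE hD cP.
  rewrite lt_def; apply/andP; split; last first.
    by rewrite cE dot_sumr big_seq sumr_ge0 // => a aD;
      rewrite dotZr mulr_ge0 ?cpos ?ltW ?vD.
  apply: contra_neq (root_nonzero hPhi cP) => vc;
    rewrite cE big_seq big1 // => a aD.
  have : \sum_(a <- Delta | a \in Delta) dot v (simple_coord Delta a c *: a)
      == 0.
    by rewrite -big_seq -dot_sumr -cE vc.
  rewrite psumr_eq0 => [|d dD]; last by rewrite dotZr mulr_ge0 ?cpos ?ltW ?vD.
  move=> /allP/(_ a aD); rewrite aD dotZr mulf_eq0 (gt_eqF (vD a aD)) orbF /=.
  by move=> /eqP->; rewrite scale0r.
move=> bP; split; first exact: pos_gt0.
have [//|/(pos_gt0 _ (rootN hPhi bP))] := root_posVneg hD bP.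
by rewrite dotNr oppr_gt0 => /lt_trans h /h; rewrite ltxx.
Qed.

End RegularBase.

(** * Weyl groups as covering groups *)

Section WeylGroup.
Local Open Scope group_scope.
Variables (R : realType) (n : nat) (Phi : {fset 'cV[R]_n}).
Hypothesis hPhi : root_system Phi.
Local Notation W := (weyl_group Phi).

Definition weyl_mx (w : W) : 'M[R]_n := val (val w).

Definition orthogonal_reflection (b : 'cV[R]_n) : orthogonal_group R n :=
  insubd (1 : orthogonal_group R n) (reflection_mx b).

(** Locked, so that deciding whether two of these elements are equal does not
   unfold the matrices behind them. *)
Definition root_reflection : 'cV[R]_n -> W :=
  locked (fun b => insubd (1 : W) (orthogonal_reflection b)).

Lemma weyl_mx_inj : injective weyl_mx.
Proof. by move=> w1 w2 /val_inj/val_inj. Qed.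

Lemma weyl_mx1 : weyl_mx 1 = 1%:M%R.
Proof. by []. Qed.

Lemma weyl_mxM w1 w2 : weyl_mx (w1 * w2) = (weyl_mx w1 *m weyl_mx w2)%R.
Proof. by []. Qed.

Lemma weyl_mxV w : weyl_mx w^-1 = ((weyl_mx w)^T)%R.
Proof. by []. Qed.

Lemma val_orthogonal_reflection b : b \in Phi ->
  val (orthogonal_reflection b) = reflection_mx b.
Proof.
by move=> bP; rewrite insubdK //;
  apply/reflection_orthogonal/(root_nonzero hPhi).
Qed.

Lemma val_root_reflection b : b \in Phi ->
  val (root_reflection b) = orthogonal_reflection b.
Proof.
move=> bP; rewrite /root_reflection -lock insubdK //.
apply/sub_generated/asboolP.
by exists b; rewrite ?val_orthogonal_reflection.
Qed.

Lemma weyl_mx_reflection b : b \in Phi ->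
  weyl_mx (root_reflection b) = reflection_mx b.
Proof.
by move=> bP; rewrite /weyl_mx val_root_reflection ?val_orthogonal_reflection.
Qed.

Lemma root_reflectionK b : b \in Phi ->
  root_reflection b * root_reflection b = 1.
Proof.
move=> bP; apply: weyl_mx_inj; rewrite weyl_mxM weyl_mx_reflection //.
by rewrite reflection_mxK // (root_nonzero hPhi).
Qed.

Lemma root_reflection_gen w :
  exists2 l : seq 'cV[R]_n,
    {subset l <= Phi} & w = \prod_(b <- l) root_reflection b.
Proof.
pose H : {pred orthogonal_group R n} := fun g =>
  `[< exists2 l : seq 'cV[R]_n, {subset l <= Phi} &
        g = \prod_(b <- l) val (root_reflection b) >].
have [l lP wE] : exists2 l : seq 'cV[R]_n, {subset l <= Phi} &
    val w = \prod_(b <- l) val (root_reflection b).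
- have /asboolP/(_ H) wH := valP w; apply/asboolP; apply: wH.
    split; first by apply/asboolP; exists [::]; rewrite ?big_nil.
    move=> g h /asboolP[l lP ->] /asboolP[m mP ->]; apply/asboolP.
    exists (l ++ rev m).
      by move=> b; rewrite mem_cat mem_rev => /orP[/lP|/mP].
    rewrite big_cat; congr (_ * _); elim: m mP => [|b m IHm] mP.
      by rewrite !big_nil invg1.
    rewrite big_cons invgM IHm; last first.
      by move=> c cm; apply: mP; rewrite inE cm orbT.
    rewrite rev_cons -cats1 big_cat /= big_seq1; congr (_ * _).
    apply: mulg1_eq; have bP := mP b (mem_head _ _).
    exact: (congr1 val (root_reflectionK bP)).
  move=> g /asboolP[b bP gE]; apply/asboolP; exists [:: b].
    by move=> c; rewrite inE => /eqP->.
  by apply: val_inj; rewrite big_seq1 gE; rewrite -weyl_mx_reflection.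
- exists l => //; apply: val_inj; rewrite wE.
  by elim: l {lP wE} => [|b l IHl]; rewrite ?big_nil // !big_cons IHl.
Qed.

Lemma weyl_mx_root w b : b \in Phi -> (weyl_mx w *m b)%R \in Phi.
Proof.
exact: (rho_root hPhi weyl_mx1 weyl_mxM weyl_mx_reflection root_reflection_gen).
Qed.

Lemma root_reflectionJ w b : b \in Phi ->
  w * root_reflection b * w^-1 = root_reflection (weyl_mx w *m b)%R.
Proof.
move=> bP; apply: weyl_mx_inj; rewrite !weyl_mxM weyl_mxV.
rewrite !weyl_mx_reflection ?weyl_mx_root //.
by rewrite reflection_mxJ //; apply: (valP (val w)).
Qed.

(** A reflection of [W] in a vector not proportional to a root would fix a
   regular vector, hence the positive roots that this vector defines. *)
Lemma weyl_reflection_root w : w \in @weyl_reflection R n Phi ->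
  exists2 b, b \in Phi & weyl_mx w = reflection_mx b.
Proof.
move=> /asboolP[a a0 wa]; apply: contrapT => nob.
have [|v [va vreg]] := @generic_orthogonal R n a Phi.
  move=> b bP k; apply/eqP => bE; apply: nob; exists b => //.
  rewrite /weyl_mx wa bE reflection_mxZ //.
  by apply: contraTneq bP => k0; rewrite bE k0 scale0r (root_neq0 hPhi).
have [Delta hD vD] := regular_base hPhi vreg.
suff w1 : w = 1.
  by have /eqP := reflection_mxN1 a0; rewrite -wa w1.
apply: (pos_preserving_eq1 hPhi weyl_mx1 weyl_mxM weyl_mx_reflection
  root_reflectionJ root_reflectionK root_reflection_gen hD) => b bD.
have bP := simple_root hD bD.
apply/(pos_root_regular hPhi hD vD); first exact: weyl_mx_root.
by rewrite /weyl_mx wa reflection_mxE /reflect dotBr dotZr va mulr0 subr0 vD.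
Qed.

Lemma root_weyl_reflection b : b \in Phi ->
  root_reflection b \in @weyl_reflection R n Phi.
Proof.
move=> bP; apply/asboolP; exists b; first exact: (root_nonzero hPhi).
exact: weyl_mx_reflection.
Qed.

Local Notation C := (quandle_of (reflections Phi)).
Local Notation GC := (quandle_group C).

Lemma quandle_root (c : C) : exists2 b, b \in Phi & val c = root_reflection b.
Proof.
have [b bP cE] := weyl_reflection_root (valP c); exists b => //.
by apply: weyl_mx_inj; rewrite weyl_mx_reflection.
Qed.

Lemma root_quandle b : b \in Phi -> exists c : C, val c = root_reflection b.
Proof.
move=> /root_weyl_reflection bC.
by exists (exist (fun w => w \in qset (reflections Phi)) _ bC).
Qed.

(** The generator of the presented group attached to a root; the default value
   1 concerns only vectors that are not roots. *)
Definition lift_reflection (b : 'cV[R]_n) : GC :=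
  oapp (pres_gen _) 1 (insub (root_reflection b) : option C).

Definition structure_mx (g : GC) : 'M[R]_n := weyl_mx (canonical_map g).

Lemma lift_reflectionE (c : C) b :
  val c = root_reflection b -> lift_reflection b = pres_gen _ c.
Proof. by rewrite /lift_reflection => <-; rewrite valK. Qed.

Lemma canonical_map_lift b : b \in Phi ->
  canonical_map (lift_reflection b) = root_reflection b.
Proof.
move=> bP; have [c cE] := root_quandle bP.
by rewrite (lift_reflectionE cE) canonical_map_gen.
Qed.

Lemma canonical_map1 : canonical_map (1 : GC) = 1.
Proof.
by apply: (mulgI (canonical_map (1 : GC))); rewrite -canonical_mapM !mulg1.
Qed.

Lemma structure_mx1 : structure_mx 1 = 1%:M%R.
Proof. by rewrite /structure_mx canonical_map1. Qed.

Lemma structure_mxM g h :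
  structure_mx (g * h) = (structure_mx g *m structure_mx h)%R.
Proof. by rewrite /structure_mx canonical_mapM. Qed.

Lemma structure_mx_lift b : b \in Phi ->
  structure_mx (lift_reflection b) = reflection_mx b.
Proof.
by move=> bP; rewrite /structure_mx canonical_map_lift ?weyl_mx_reflection.
Qed.

Lemma pres_genK (c : C) : pres_gen (@quandle_rel C) c * pres_gen _ c = 1 :> GC.
Proof.
have cV : qinv c = c.
  have [b bP cE] := quandle_root c; apply: val_inj; rewrite /= cE.
  by apply: mulg1_eq; apply: root_reflectionK.
rewrite -{1}cV; apply: etrans (pres_mulE _ _ _) _.
by apply/pres_classP; apply: pres_rel; apply: quandle_rel_inv.
Qed.

Lemma pres_gen_qact (c d : C) :
  pres_gen (@quandle_rel C) (qact c d) =
    pres_gen _ c * pres_gen _ d * (pres_gen _ c)^-1 :> GC.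
Proof.
apply: (mulIg (pres_gen _ c)); rewrite mulgVK.
apply: etrans (pres_mulE _ _ _) _; apply/esym.
apply: etrans (pres_mulE _ _ _) _.
by apply/esym/pres_classP; apply: pres_rel; apply: quandle_rel_conj.
Qed.

Lemma lift_reflectionK b : b \in Phi ->
  lift_reflection b * lift_reflection b = 1.
Proof.
move=> bP; have [c cE] := root_quandle bP.
by rewrite (lift_reflectionE cE) pres_genK.
Qed.

Lemma lift_reflection_gen g :
  exists2 l : seq 'cV[R]_n,
    {subset l <= Phi} & g = \prod_(b <- l) lift_reflection b.
Proof.
rewrite -[g]pres_classK; elim: (repr g) => [|[s c] u [l lP ul]].
  by exists [::]; rewrite ?big_nil.
have [b bP cE] := quandle_root c.
exists (b :: l); first by move=> d; rewrite inE => /predU1P[->|/lP].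
rewrite big_cons -ul (lift_reflectionE cE);
  apply: etrans (esym (pres_mulE _ [:: _] _)) _.
congr (_ * _); case: s => //.
apply: etrans (esym (pres_invE _ [:: (true, c)])) _.
by apply: mulg1_eq; apply: pres_genK.
Qed.

Lemma structure_mx_root g b : b \in Phi -> (structure_mx g *m b)%R \in Phi.
Proof. exact: weyl_mx_root. Qed.

(** The defining relations give this for [g] a generator; the general case
   follows by induction on a word for [g]. *)
Lemma lift_reflectionJ g b : b \in Phi ->
  g * lift_reflection b * g^-1 = lift_reflection (structure_mx g *m b)%R.
Proof.
have [l lP ->] := lift_reflection_gen g; elim: l lP b => [|a l IHl] lP b bP.
  by rewrite big_nil structure_mx1 mul1mx mul1g invg1 mulg1.
have aP := lP a (mem_head _ _).
rewrite big_cons structure_mxM structure_mx_lift // -mulmxA reflection_mxE.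
set g' := \prod_(c <- l) _.
set xa := lift_reflection a; set xb := lift_reflection b.
have -> : xa * g' * xb * (xa * g')^-1 = xa * (g' * xb * g'^-1) * xa^-1.
  by rewrite invgM !mulgA.
rewrite {}IHl //; last by move=> d dl; apply: lP; rewrite inE dl orbT.
have b'P := structure_mx_root g' bP; set b' := (_ *m b)%R in b'P *.
have [c cE] := root_quandle aP.
have [d dE] := root_quandle b'P.
rewrite /xa (lift_reflectionE cE) (lift_reflectionE dE) -pres_gen_qact.
apply/esym/lift_reflectionE.
by rewrite /= cE dE root_reflectionJ // weyl_mx_reflection // reflection_mxE.
Qed.

Lemma canonical_map_inj : injective (@canonical_map _ (reflections Phi)).
Proof.
have [Delta hD] := base_exists hPhi; move=> g h gh.
apply: (rho_inj hPhi structure_mx1 structure_mxM structure_mx_lift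
  lift_reflectionJ lift_reflectionK lift_reflection_gen hD).
by rewrite /structure_mx gh.
Qed.

Lemma reflections_generate : generates (reflections Phi).
Proof.
move=> w; apply/asboolP => H [H1 HV] CH.
have [l lP ->] := root_reflection_gen w.
elim: l lP => [|b l IHl] lP; first by rewrite big_nil.
rewrite big_cons; apply: (group_closedM (conj H1 HV)).
  by apply/CH/root_weyl_reflection/lP/mem_head.
by apply: IHl => c cl; apply: lP; rewrite inE cl orbT.
Qed.

Lemma weyl_covering : covering_group (reflections Phi).
Proof.
split; first exact: reflections_generate.
have surj w : exists g : GC, canonical_map g = w.
  have [l lP ->] := root_reflection_gen w.
  exists (\prod_(b <- l) lift_reflection b).
  elim: l lP => [|b l IHl] lP; first by rewrite !big_nil canonical_map1.
  rewrite !big_cons canonical_mapM canonical_map_lift ?lP ?mem_head // IHl //.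
  by move=> c cl; apply: lP; rewrite inE cl orbT.
pose inv w := sval (cid (surj w)).
have invK w : canonical_map (inv w) = w by rewrite /inv; case: cid.
by exists inv => // g; apply: canonical_map_inj; rewrite invK.
Qed.

End WeylGroup.

(** * Skew reflections and simply laced diagrams *)

Section SkewGraph.
Variable C : ipQuandleType.
Implicit Types c d g : C.

Definition skew_edge : rel C := fun c d => (c != d) && mutually_skew c d.

Definition skew_joined c d := exists2 p, path skew_edge c p & last c p = d.

Lemma skew_edge_sym : symmetric skew_edge.
Proof.
move=> c d; rewrite /skew_edge eq_sym; congr (_ && _); rewrite /mutually_skew.
by rewrite -(inj_eq (can_inj (@qinvK C))) qinvK eq_sym.
Qed.

Lemma skew_joined_refl c : skew_joined c c.
Proof. by exists [::]. Qed.

Lemma skew_joined_trans d c g : skew_joined c d -> skew_joined d g ->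
  skew_joined c g.
Proof.
move=> [p cp <-] [q cq <-]; exists (p ++ q); last by rewrite last_cat.
by rewrite cat_path cp.
Qed.

Lemma skew_edge_joined c d : skew_edge c d -> skew_joined c d.
Proof. by move=> cd; exists [:: d]; rewrite //= cd. Qed.

Lemma skew_joined_sym c d : skew_joined c d -> skew_joined d c.
Proof.
move=> [p cp <-]; elim: p c cp => [|g p IHp] c /=; first by exists [::].
move=> /andP[cg gp]; apply: skew_joined_trans (IHp g gp) _.
by apply: skew_edge_joined; rewrite skew_edge_sym.
Qed.

Lemma skew_edge_qact g c d : skew_edge c d -> skew_edge (qact g c) (qact g d).
Proof.
move=> /andP[cd /eqP sk]; apply/andP; split.
  by rewrite (inj_eq (bij_inj (qact_bij g))).
by rewrite /mutually_skew -!qactA sk qactV.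
Qed.

Lemma skew_joined_qact g c d : skew_joined c d ->
  skew_joined (qact g c) (qact g d).
Proof.
move=> [p cp <-]; exists (map (qact g) p); last by rewrite last_map.
by apply: homo_path cp => x y; apply: skew_edge_qact.
Qed.

Lemma locally_skewP : locally_skew C <-> forall c d, skew_joined c d.
Proof.
split=> [sk c d|sk c d _ _].
  by have [//|//|p [_ cp pd]] := sk c d; exists p.
by have [p cp pd] := sk c d; exists p; split=> //; apply/allP.
Qed.

End SkewGraph.

Section SkewReflections.
Variables (R : realType) (n : nat) (Phi : {fset 'cV[R]_n}).
Hypothesis hPhi : root_system Phi.
Local Notation C := (quandle_of (reflections Phi)).
Implicit Types (a b : 'cV[R]_n) (c d : C).

Lemma root_reflectionN b : root_reflection Phi (- b) = root_reflection Phi b.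
Proof.
by rewrite /root_reflection -lock /orthogonal_reflection reflection_mxN.
Qed.

Lemma root_reflection_inj a b : a \in Phi -> b \in Phi ->
  root_reflection Phi a = root_reflection Phi b -> b = a \/ b = - a.
Proof.
move=> aP bP /(congr1 (@weyl_mx R n Phi)).
rewrite (weyl_mx_reflection hPhi aP) (weyl_mx_reflection hPhi bP).
exact: (reflection_mx_root_inj hPhi aP bP).
Qed.

Lemma root_reflection_qact c d a b : a \in Phi -> b \in Phi ->
    val c = root_reflection Phi a -> val d = root_reflection Phi b ->
  val (qact c d) = root_reflection Phi (reflect a b).
Proof.
move=> aP bP cE dE.
have -> : val (qact c d) = (val c * val d * (val c)^-1)%g by [].
rewrite cE dE.
by rewrite (root_reflectionJ hPhi _ bP) (weyl_mx_reflection hPhi aP)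
  reflection_mxE.
Qed.

Lemma root_reflectionV b : b \in Phi ->
  (root_reflection Phi b)^-1%g = root_reflection Phi b.
Proof. by move=> bP; apply: mulg1_eq; apply: (root_reflectionK hPhi). Qed.

(** The two conjugates are the reflections in [reflect a b] and [reflect b a],
   and these are involutions, so that the inversion in the definition of
   skewness is invisible. *)
Lemma mutually_skewP c d a b : a \in Phi -> b \in Phi ->
    val c = root_reflection Phi a -> val d = root_reflection Phi b ->
  mutually_skew c d <->
    reflect b a = reflect a b \/ reflect b a = - reflect a b.
Proof.
move=> aP bP cE dE.
have dcV : val (qinv (qact d c)) = root_reflection Phi (reflect b a).
  have -> : val (qinv (qact d c)) = (val (qact d c))^-1%g by [].
  rewrite (root_reflection_qact bP aP dE cE).
  by rewrite root_reflectionV // root_reflect.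
split=> [/eqP/(congr1 val)|ab].
  rewrite (root_reflection_qact aP bP cE dE) dcV.
  by apply: root_reflection_inj; apply: root_reflect.
apply/eqP/val_inj; rewrite (root_reflection_qact aP bP cE dE) dcV.
by case: ab => ->; rewrite ?root_reflectionN.
Qed.

(** Along an edge, the norms of [reflect b a] and [reflect a b] agree, and
   reflections are isometries. *)
Lemma skew_joined_length c d a b : a \in Phi -> b \in Phi ->
    val c = root_reflection Phi a -> val d = root_reflection Phi b ->
  skew_joined c d -> dot a a = dot b b.
Proof.
move=> aP bP cE dE [p cp pd].
elim: p c a aP cE cp pd => [|g p IHp] c a aP cE /=.
  move=> _ cd; move: dE; rewrite -cd cE =>
    /(root_reflection_inj aP bP)[->//|->].
  by rewrite dotNl dotNr opprK.
move=> /andP[/andP[_ cg] gp] pd; have [e eP gE] := quandle_root hPhi g.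
rewrite -(IHp g e) //.
have a0 := root_nonzero hPhi aP; have e0 := root_nonzero hPhi eP.
rewrite -(dot_reflect a a e0) -(dot_reflect e e a0).
have [->|->] := (mutually_skewP aP eP cE gE).1 cg; first by [].
by rewrite dotNl dotNr opprK.
Qed.

(** Both Cartan integers equal the same [k], and [b - a], [b + a] being nonzero
   means that [-2 < k < 2]. *)
Lemma dynkin_edges_equal_length a b : a \in Phi -> b \in Phi ->
  dot a a = dot b b -> b != a -> b != - a -> dynkin_edges a b <= 1.
Proof.
move=> aP bP ab bNa bNNa.
have aa := dot_gt0 (root_nonzero hPhi aP).
have /intrP[k kE] := root_crystal hPhi aP bP.
have kE' : cartan a b = k%:~R by rewrite -kE /cartan dotC ab.
have kab : 2 * dot a b = k%:~R * dot a a by rewrite dotC -kE divfK // gt_eqF.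
have : 0 < dot (b - a) (b - a) by rewrite dot_gt0 // subr_eq0.
have : 0 < dot (b + a) (b + a) by rewrite dot_gt0 // addr_eq0.
rewrite !(dotDl, dotDr, dotNl, dotNr) opprK -ab (dotC b a) => lo hi.
have k_lt2 : k < 2.
  by rewrite -(ltr_int R) -(ltr_pM2r aa) -kab; lra.
have k_gtN2 : -2 < k.
  by rewrite -(ltr_int R) -(ltr_pM2r aa) -kab; lra.
rewrite /dynkin_edges kE kE' -intrM (ler_int R _ 1).
have : -1 <= k <= 1 by lia.
by nia.
Qed.

Section Base.
Variable Delta : {fset 'cV[R]_n}.
Hypothesis hD : base Phi Delta.

Lemma locally_skew_simply_laced : locally_skew C -> simply_laced Delta.
Proof.
move=> /locally_skewP sk a b aD bD ab.
have aP := simple_root hD aD; have bP := simple_root hD bD.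
have [c cE] := root_quandle hPhi aP; have [d dE] := root_quandle hPhi bP.
apply: dynkin_edges_equal_length => //.
- exact: skew_joined_length cE dE (sk c d).
- by rewrite eq_sym.
apply/eqP => bE; apply: (pos_rootN hPhi hD aP (simple_pos hD aD)).
by rewrite -bE; apply: (simple_pos hD).
Qed.

(** An edge of multiplicity 1 forces both Cartan integers to be 1 or both to be
   -1; then [reflect a b] and [reflect b a] are [b - a] and [a - b], or both
   [a + b]. *)
Lemma dynkin_edge_skew c d a b :
    simply_laced Delta -> a \in Delta -> b \in Delta ->
    val c = root_reflection Phi a -> val d = root_reflection Phi b ->
  a != b -> dynkin_edges a b != 0 -> mutually_skew c d.
Proof.
move=> lac aD bD cE dE ab edge_neq0.
have aP := simple_root hD aD; have bP := simple_root hD bD.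
have edge_le1 := lac a b aD bD ab.
apply/(mutually_skewP aP bP cE dE).
have aa := dot_gt0 (root_nonzero hPhi aP).
have bb := dot_gt0 (root_nonzero hPhi bP).
have edge_ge0 : 0 <= dynkin_edges a b.
  rewrite /dynkin_edges /cartan (dotC b a) mulrACA -expr2.
  by rewrite mulr_ge0 ?sqr_ge0 // mulr_ge0 // invr_ge0 ltW.
have /intrP[k kE] := root_crystal hPhi aP bP.
have /intrP[m mE] := root_crystal hPhi bP aP.
move: edge_neq0 edge_le1 edge_ge0.
rewrite /dynkin_edges kE mE -intrM intr_eq0 (ler_int R _ 1) (ler_int R 0) =>
  km0 km_le1 km_ge0.
have km1 : k * m = 1 by lia.
have [[k1 m1]|[k1 m1]] : (k = 1 /\ m = 1) \/ (k = -1 /\ m = -1).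
- have [k_gt0|k_le0] := ltrP 0 k; [left | right].
    have m_gt0 : 0 < m by rewrite -(pmulr_rgt0 _ k_gt0) km1.
    by nia.
  have k_lt0 : k < 0.
    rewrite lt_neqAle k_le0 andbT; apply/eqP => k0.
    by move: km1; rewrite k0 mul0r.
  have m_lt0 : m < 0 by rewrite -(nmulr_rgt0 _ k_lt0) km1.
  by nia.
- by right; rewrite /reflect kE mE k1 m1 !scale1r opprB.
- by left; rewrite /reflect kE mE k1 m1 !scaleN1r !opprK addrC.
Qed.

Lemma simple_skew_joined c d a b :
    dynkin_connected Delta -> simply_laced Delta ->
    a \in Delta -> b \in Delta ->
    val c = root_reflection Phi a -> val d = root_reflection Phi b ->
  skew_joined c d.
Proof.
move=> conn lac aD bD cE dE; have [p [pD ap pb]] := conn a b aD bD.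
elim: p a c aD cE pD ap pb => [|e p IHp] a c aD cE /=.
  move=> _ _ ab; suff -> : c = d by exact: skew_joined_refl.
  by apply: val_inj; rewrite cE dE ab.
move=> /andP[eD pD] /andP[/andP[ae edge] ep] pb.
have [g gE] := root_quandle hPhi (simple_root hD eD).
apply: (@skew_joined_trans _ g); last exact: (IHp e).
have [->|cg] := eqVneq c g; first exact: skew_joined_refl.
apply: skew_edge_joined; rewrite /skew_edge cg /=.
exact: dynkin_edge_skew cE gE ae edge.
Qed.

(** It suffices to join every reflection to a simple one, by [root_ind]. If the
   reflection [d] is so joined, it is also joined to the simple reflection [g],
   and conjugating that path by [g] joins [qact g d] to [g]. *)
Lemma simply_laced_locally_skew :
  dynkin_connected Delta -> simply_laced Delta -> locally_skew C.
Proof.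
move=> conn lac; apply/locally_skewP.
have to_simple b : b \in Phi -> forall c, val c = root_reflection Phi b ->
    exists a d,
      [/\ a \in Delta, val d = root_reflection Phi a & skew_joined c d].
  move=> bP; elim/(root_ind hPhi hD): b / bP =>
    [a aD c cE|b IHb c|a b aD bP IHb c cE].
  - by exists a, c; split=> //; apply: skew_joined_refl.
  - by rewrite root_reflectionN; apply: IHb.
  have aP := simple_root hD aD.
  have [d dE] := root_quandle hPhi bP; have [g gE] := root_quandle hPhi aP.
  have [a' [d' [a'D d'E dd']]] := IHb d dE.
  have dg := skew_joined_trans dd' (simple_skew_joined conn lac a'D aD d'E gE).
  exists a, g; split=> //; have := skew_joined_qact g dg; rewrite qact_idem.
  suff -> : qact g d = c by [].
  by apply: val_inj; rewrite (root_reflection_qact aP bP gE dE) cE.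
move=> c d; have [b bP cE] := quandle_root hPhi c.
have [e eP dE] := quandle_root hPhi d.
have [a1 [c1 [a1D c1E cc1]]] := to_simple b bP c cE.
have [a2 [c2 [a2D c2E dc2]]] := to_simple e eP d dE.
apply: skew_joined_trans cc1 _; apply: skew_joined_trans (skew_joined_sym dc2).
exact: simple_skew_joined c1E c2E.
Qed.

End Base.
End SkewReflections.

Theorem theorem3p1 (R : realType) (n : nat) (Phi : {fset 'cV[R]_n})
    (hPhi : root_system Phi) :
  covering_group (reflections Phi) /\
  (forall Delta : {fset 'cV[R]_n}, base Phi Delta ->
    (locally_skew (quandle_of (reflections Phi)) -> simply_laced Delta) /\
    (dynkin_connected Delta -> simply_laced Delta ->
       locally_skew (quandle_of (reflections Phi)))).
Proof.
split; first exact: weyl_covering.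
move=> Delta hD; split; first exact: locally_skew_simply_laced.
exact: simply_laced_locally_skew.
Qed.
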